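(* Let $d\in\{1,2\}$, let $M,C,k,S$ be positive integers with $k$ odd, and let $N$ be a positive integer such that $SN\geq k$. Let $\mathbb{K}_d^{\perp}$ be the set of kernel tensors $\mathbf{K}\in\mathbb{K}_d$ whose associated circular convolutional layer transform matrix $\mathcal{K}$ (for this $S$ and $N$) is orthogonal. \begin{itemize} \item RO case: if $M\leq CS^d$, then $\mathbb{K}_d^{\perp}\neq\emptyset$ if and only if $M\leq Ck^d$. \item CO case: if $M\geq CS^d$, then $\mathbb{K}_d^{\perp}\neq\emptyset$ if and only if $S\leq k$. \end{itemize}
   Context: Write $k=2r+1$, and let $a\%n\in\{0,\dots,n-1\}$ denote the remainder of $a$ modulo $n$. The integers $M$, $C$, $k$, $S$ are the number of output channels, number of input channels, kernel size and stride. Kernel tensors: $\mathbb{K}_1=\mathbb{R}^{M\times C\times k}$ and $\mathbb{K}_2=\mathbb{R}^{M\times C\times k\times k}$; kernel spatial indices run from $0$ to $k-1$. Layer transform matrix (circular boundary conditions). For $d=1$, $\mathcal{K}\in\mathbb{R}^{MN\times CSN}$ is the matrix of the linear map $X\in\mathbb{R}^{C\times SN}\mapsto Y\in\mathbb{R}^{M\times N}$ (after vectorization) given, for $1\le m\le M$, $0\le i\le N-1$, by $$Y_{m,i}=\sum_{c=1}^C\sum_{i'=0}^{k-1}\mathbf{K}_{m,c,i'}\,X_{c,(i'+Si-r)\%SN}.$$ For $d=2$, $\mathcal{K}\in\mathbb{R}^{MN^2\times CS^2N^2}$ is the matrix of the linear map $X\in\mathbb{R}^{C\times SN\times SN}\mapsto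 Y\in\mathbb{R}^{M\times N\times N}$ given, for $0\le i,j\le N-1$, by $$Y_{m,i,j}=\sum_{c=1}^C\sum_{i'=0}^{k-1}\sum_{j'=0}^{k-1}\mathbf{K}_{m,c,i',j'}\,X_{c,(i'+Si-r)\%SN,(j'+Sj-r)\%SN}.$$ Orthogonality. In the RO (row) case $M\le CS^d$, $\mathcal{K}$ is called orthogonal if $\mathcal{K}\mathcal{K}^T=\mathrm{Id}_{MN^d}$. In the CO (column) case $M\ge CS^d$, $\mathcal{K}$ is called orthogonal if $\mathcal{K}^T\mathcal{K}=\mathrm{Id}_{CS^dN^d}$. (When $M=CS^d$ the matrix is square and the two notions coincide.) *)

(* Defs.v *)
From HB Require Import structures.
From mathcomp Require Import all_boot all_order all_algebra.
From mathcomp Require Import classical_sets reals.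

Set Implicit Arguments.
Unset Strict Implicit.
Unset Printing Implicit Defensive.

Import Order.TTheory GRing.Theory Num.Theory.
Local Open Scope ring_scope.
Local Open Scope classical_set_scope.

Definition kernel1 (R : realType) (M C k : nat) : Type :=
  'I_M -> 'I_C -> 'I_k -> R.

Definition kernel2 (R : realType) (M C k : nat) : Type :=
  'I_M -> 'I_C -> 'I_k -> 'I_k -> R.

Lemma absz_mod_lt (n : nat) (n_gt0 : (0 < n)%N) (a : int) :
  (absz (a %% n%:Z)%Z < n)%N.
Proof.
have n_neq0 : n%:Z != 0 by rewrite eqz_nat -lt0n.
by rewrite -ltz_nat gez0_abs ?modz_ge0 ?ltz_pmod.
Qed.

(* The remainder is taken in int, so a may be negative. *)
Definition circ_ord (n : nat) (n_gt0 : (0 < n)%N) (a : int) : 'I_n :=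
  Ordinal (absz_mod_lt n_gt0 a).

Lemma SN_gt0 (S N : nat) (S_gt0 : (0 < S)%N) (N_gt0 : (0 < N)%N) :
  (0 < S * N)%N.
Proof. by rewrite muln_gt0 S_gt0 N_gt0. Qed.

(* The input position (i' + S i - r) % SN, with r = k./2, i.e. k = 2 r + 1 when
   k is odd. *)
Definition input_pos (k S N : nat) (S_gt0 : (0 < S)%N) (N_gt0 : (0 < N)%N)
    (i' : 'I_k) (i : 'I_N) : 'I_(S * N) :=
  circ_ord (SN_gt0 S_gt0 N_gt0) (i'%:Z + S%:Z * i%:Z - (k./2)%:Z).

Definition conv1 (R : realType) (M C k S N : nat)
    (S_gt0 : (0 < S)%N) (N_gt0 : (0 < N)%N) (K : kernel1 R M C k)
    (X : 'M[R]_(C, S * N)) : 'M[R]_(M, N) :=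
  \matrix_(m < M, i < N)
    \sum_(c < C) \sum_(i' < k) K m c i' * X c (input_pos S_gt0 N_gt0 i' i).

(* An element of R^(C x SN x SN) is encoded as a matrix whose row c is the
   vectorization mxvec of the SN x SN image on channel c; same for outputs. *)
Definition conv2 (R : realType) (M C k S N : nat)
    (S_gt0 : (0 < S)%N) (N_gt0 : (0 < N)%N) (K : kernel2 R M C k)
    (X : 'M[R]_(C, (S * N) * (S * N))) : 'M[R]_(M, N * N) :=
  \matrix_(m < M) mxvec (\matrix_(i < N, j < N)
    \sum_(c < C) \sum_(i' < k) \sum_(j' < k)
      K m c i' j' * vec_mx (row c X) (input_pos S_gt0 N_gt0 i' i)
                                     (input_pos S_gt0 N_gt0 j' j)).

Lemma conv1_is_linear (R : realType) (M C k S N : nat)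
    (S_gt0 : (0 < S)%N) (N_gt0 : (0 < N)%N) (K : kernel1 R M C k) :
  linear (conv1 S_gt0 N_gt0 K).
Proof.
move=> a X Y; apply/matrixP=> m i; rewrite !mxE mulr_sumr -big_split /=.
apply: eq_bigr => c _; rewrite mulr_sumr -big_split /=.
by apply: eq_bigr => i' _; rewrite !mxE mulrDr mulrCA.
Qed.

HB.instance Definition _ (R : realType) (M C k S N : nat)
    (S_gt0 : (0 < S)%N) (N_gt0 : (0 < N)%N) (K : kernel1 R M C k) :=
  GRing.isLinear.Build R 'M[R]_(C, S * N) 'M[R]_(M, N) _ (conv1 S_gt0 N_gt0 K)
    (conv1_is_linear S_gt0 N_gt0 K).

Lemma conv2_is_linear (R : realType) (M C k S N : nat)
    (S_gt0 : (0 < S)%N) (N_gt0 : (0 < N)%N) (K : kernel2 R M C k) :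
  linear (conv2 S_gt0 N_gt0 K).
Proof.
move=> a X Y; apply/row_matrixP=> m; rewrite linearP /= !rowK -linearP /=.
congr mxvec; apply/matrixP=> i j; rewrite !mxE mulr_sumr -big_split /=.
apply: eq_bigr => c _; rewrite mulr_sumr -big_split /=.
apply: eq_bigr => i' _; rewrite mulr_sumr -big_split /=.
by apply: eq_bigr => j' _; rewrite !mxE mulrDr mulrCA.
Qed.

HB.instance Definition _ (R : realType) (M C k S N : nat)
    (S_gt0 : (0 < S)%N) (N_gt0 : (0 < N)%N) (K : kernel2 R M C k) :=
  GRing.isLinear.Build R 'M[R]_(C, (S * N) * (S * N)) 'M[R]_(M, N * N) _
    (conv2 S_gt0 N_gt0 K) (conv2_is_linear S_gt0 N_gt0 K).

(* lin_mx represents a linear map acting on row vectors from the right; the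
   transpose acts on column vectors from the left, see layer1_mxP. *)
Definition layer1_mx (R : realType) (M C k S N : nat)
    (S_gt0 : (0 < S)%N) (N_gt0 : (0 < N)%N) (K : kernel1 R M C k) :
    'M[R]_(M * N, C * (S * N)) :=
  (lin_mx (conv1 S_gt0 N_gt0 K))^T.

Definition layer2_mx (R : realType) (M C k S N : nat)
    (S_gt0 : (0 < S)%N) (N_gt0 : (0 < N)%N) (K : kernel2 R M C k) :
    'M[R]_(M * (N * N), C * ((S * N) * (S * N))) :=
  (lin_mx (conv2 S_gt0 N_gt0 K))^T.

Lemma layer1_mxP (R : realType) (M C k S N : nat)
    (S_gt0 : (0 < S)%N) (N_gt0 : (0 < N)%N) (K : kernel1 R M C k)
    (X : 'M[R]_(C, S * N)) :
  layer1_mx S_gt0 N_gt0 K *m (mxvec X)^T = (mxvec (conv1 S_gt0 N_gt0 K X))^T.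
Proof. by rewrite -trmx_mul mul_vec_lin. Qed.

Lemma layer2_mxP (R : realType) (M C k S N : nat)
    (S_gt0 : (0 < S)%N) (N_gt0 : (0 < N)%N) (K : kernel2 R M C k)
    (X : 'M[R]_(C, (S * N) * (S * N))) :
  layer2_mx S_gt0 N_gt0 K *m (mxvec X)^T = (mxvec (conv2 S_gt0 N_gt0 K X))^T.
Proof. by rewrite -trmx_mul mul_vec_lin. Qed.

(* When M = C S^d the matrix is square and the two conditions coincide. *)
Definition orthogonal_kernels1 (R : realType) (M C k S N : nat)
    (S_gt0 : (0 < S)%N) (N_gt0 : (0 < N)%N) : set (kernel1 R M C k) :=
  [set K | let A := layer1_mx S_gt0 N_gt0 K in
     ((M <= C * S)%N -> A *m A^T = 1%:M) /\
     ((C * S <= M)%N -> A^T *m A = 1%:M)].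

Definition orthogonal_kernels2 (R : realType) (M C k S N : nat)
    (S_gt0 : (0 < S)%N) (N_gt0 : (0 < N)%N) : set (kernel2 R M C k) :=
  [set K | let A := layer2_mx S_gt0 N_gt0 K in
     ((M <= C * S ^ 2)%N -> A *m A^T = 1%:M) /\
     ((C * S ^ 2 <= M)%N -> A^T *m A = 1%:M)].

Arguments orthogonal_kernels1 R M C k {S N} S_gt0 N_gt0.
Arguments orthogonal_kernels2 R M C k {S N} S_gt0 N_gt0.

(* Main.v *)
Require Import Defs.
From HB Require Import structures.
From mathcomp Require Import all_boot all_order all_algebra.
From mathcomp Require Import classical_sets reals.

Set Implicit Arguments.
Unset Strict Implicit.
Unset Printing Implicit Defensive.

Local Open Scope classical_set_scope.
Local Open Scope nat_scope.

(** Both dimensions are instances of one operator: a kernel over a finite set of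
    taps [I], whose tap [t] at output position [o] reads the input position
    [pos t o].  If the rows are orthonormal, those attached to one fixed output
    position are independent and factor through the [C * #|I|] kernel
    coefficients, so [M <= C * #|I|].  If the columns are orthonormal, none
    vanishes, so every input position is read and [S N <= k N].  Conversely, the
    first [min(S, k)] taps in each direction read pairwise distinct input
    positions, and a kernel matching the output channels with the pairs (input
    channel, such tap) yields a partial permutation matrix. *)

(** * Orthonormal families indexed by finite types *)

Section Orthonormality.
Import GRing.Theory.
Local Open Scope ring_scope.
Variable R : comNzRingType.

(** Finite types allow rows and columns to be indexed by pairs of a channel and a position. Column
    orthonormality is the same predicate with the arguments of [L] swapped. *)
Definition row_orthonormal (U V : finType) (L : U -> V -> R) : Prop :=
  forall u u', \sum_v L u v * L u' v = (u == u')%:R.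

Lemma sum_pred1_mul (T : finType) (x : T) (F : T -> R) :
  \sum_y (x == y)%:R * F y = F x.
Proof.
rewrite (bigD1 x) //= eqxx mul1r big1 ?addr0 // => y /negPf.
by rewrite eq_sym => ->; rewrite mul0r.
Qed.

Lemma row_orthonormal_graph (U V : finType) (f : U -> V) (L : U -> V -> R) :
  injective f -> (forall u v, L u v = (f u == v)%:R) -> row_orthonormal L.
Proof.
move=> f_inj LE u u'; under eq_bigr do rewrite !LE.
by rewrite sum_pred1_mul eq_sym (inj_eq f_inj) eq_sym.
Qed.

(** Reindexing the columns along [g] leaves inner products of rows unchanged, and [f] only renames
    the entries of the Gram matrix. *)
Lemma row_orthonormal_mx (U V : finType) (a b : nat) (f : U -> 'I_a)
    (g : V -> 'I_b) (A : 'M[R]_(a, b)) :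
  bijective f -> bijective g ->
  A *m A^T = 1%:M <-> row_orthonormal (fun u v => A (f u) (g v)).
Proof.
move=> f_bij g_bij.
have AE u u' : (A *m A^T) (f u) (f u') = \sum_v A (f u) (g v) * A (f u') (g v).
  rewrite mxE (reindex g) /=; last exact: onW_bij.
  by apply: eq_bigr => v _; rewrite mxE.
split=> [A_orth u u' | A_orth].
  by rewrite -AE A_orth mxE (inj_eq (bij_inj f_bij)).
have [h fK hK] := f_bij.
apply/matrixP=> x y; rewrite -(hK x) -(hK y) AE A_orth mxE.
by rewrite (inj_eq (bij_inj f_bij)).
Qed.

Lemma col_orthonormal_mx (U V : finType) (a b : nat) (f : U -> 'I_a)
    (g : V -> 'I_b) (A : 'M[R]_(a, b)) :
  bijective f -> bijective g ->
  A^T *m A = 1%:M <-> row_orthonormal (fun v u => A (f u) (g v)).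
Proof.
move=> f_bij g_bij; rewrite -{2}[A]trmxK (row_orthonormal_mx _ g_bij f_bij).
by split=> orth v v'; rewrite -orth; apply: eq_bigr => u _; rewrite !mxE.
Qed.

End Orthonormality.

(** * Bounds and matching kernels for an arbitrary finite set of taps *)

Section AbstractConvolution.
Import GRing.Theory.
Local Open Scope ring_scope.
Variables (R : realType) (M C : nat) (I O P : finType) (pos : I -> O -> P).

(** The sum over taps is there because [pos] is arbitrary: several taps may read the same input
    position. *)
Definition layer_entry (K : 'I_M -> 'I_C -> I -> R)
    (u : 'I_M * O) (v : 'I_C * P) : R :=
  \sum_t K u.1 v.1 t * (pos t u.2 == v.2)%:R.

Lemma channels_le_of_row_orthonormal (K : 'I_M -> 'I_C -> I -> R) (o : O) :
  row_orthonormal (layer_entry K) -> (M <= C * #|I|)%N.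
Proof.
move=> K_orth.
(* [B] is the kernel flattened to [M] rows, and [D] samples the rows attached to [o] at the
   positions read by the taps. Grouping taps by the position they read turns [B *m D] into the Gram
   matrix of those rows. *)
pose B : 'M[R]_(M, #|{: 'I_C * I}|) :=
  \matrix_(m, x) K m (enum_val x).1 (enum_val x).2.
pose D : 'M[R]_(#|{: 'I_C * I}|, M) :=
  \matrix_(x, m) layer_entry K (m, o) ((enum_val x).1, pos (enum_val x).2 o).
have BD : B *m D = 1%:M.
  apply/matrixP=> m m'; rewrite !mxE.
  transitivity (((m, o) == (m', o))%:R : R); last first.
    by rewrite xpair_eqE eqxx andbT.
  rewrite -K_orth.
  transitivity (\sum_(x : 'I_C * I)
      K m x.1 x.2 * layer_entry K (m', o) (x.1, pos x.2 o)).
    rewrite [RHS](reindex (@enum_val _ {: 'I_C * I})) /=; last first.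
      exact/onW_bij/enum_val_bij.
    by apply: eq_bigr => x _; rewrite !mxE.
  rewrite -(pair_bigA _
    (fun c t => K m c t * layer_entry K (m', o) (c, pos t o))).
  rewrite -(pair_bigA _
    (fun c p => layer_entry K (m, o) (c, p) * layer_entry K (m', o) (c, p))).
  apply: eq_bigr => c _ /=.
  under [RHS]eq_bigr do rewrite {1}/layer_entry /= mulr_suml.
  rewrite exchange_big /=; apply: eq_bigr => t _.
  under eq_bigr do rewrite -mulrA.
  by rewrite -mulr_sumr sum_pred1_mul.
by have := mulmx1_min BD; rewrite card_prod card_ord.
Qed.

Lemma positions_le_of_col_orthonormal (K : 'I_M -> 'I_C -> I -> R) (c : 'I_C) :
  row_orthonormal (fun v u => layer_entry K u v) -> (#|P| <= #|I| * #|O|)%N.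
Proof.
move=> K_orth; rewrite -card_prod.
have pos_surj p : p \in codom (fun x : I * O => pos x.1 x.2).
  (* If no tap reads [p], the column of [(c, p)] is zero, yet its squared norm is 1. *)
  apply/negP=> /negP p_notin; have := K_orth (c, p) (c, p).
  rewrite eqxx big1 => [/esym/eqP | u _]; first by rewrite oner_eq0.
  rewrite /layer_entry big1 ?mul0r // => t _ /=.
  case: eqP => [tp | _]; last by rewrite mulr0.
  by case/negP: p_notin; apply/codomP; exists (t, u.2).
rewrite -(size_codom (fun x : I * O => pos x.1 x.2)).
apply: leq_trans (card_size _).
by apply: subset_leq_card; apply/fintype.subsetP => p _; apply: pos_surj.
Qed.

Variables (J : finType) (iota : J -> I).
Hypothesis pos_inj : injective (fun x : J * O => pos (iota x.1) x.2).

(* The [m]-th output channel copies the [m]-th pair (input channel, tap in [J]);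
   channels in excess on either side are left unmatched. *)
Definition matching_kernel (m : 'I_M) (c : 'I_C) (t : I) : R :=
  \sum_j (iota j == t)%:R * (enum_rank (c, j) == m :> nat)%:R.

Lemma layer_entry_matching u v : layer_entry matching_kernel u v =
  \sum_j (enum_rank (v.1, j) == u.1 :> nat)%:R * (pos (iota j) u.2 == v.2)%:R.
Proof.
rewrite /layer_entry; under eq_bigr do rewrite mulr_suml.
rewrite exchange_big /=; apply: eq_bigr => j _.
by under eq_bigr do rewrite -mulrA; rewrite sum_pred1_mul.
Qed.

(** The row of [(m, o)] has a single 1, in the column formed by the input channel matched with [m]
    and the position that its matched tap reads from [o]. These columns are distinct because the
    matching is injective and by [pos_inj]. *)
Lemma matching_row_orthonormal : (M <= C * #|J|)%N ->
  row_orthonormal (layer_entry matching_kernel).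
Proof.
move=> M_le.
have M_le' : (M <= #|{: 'I_C * J}|)%N by rewrite card_prod card_ord.
pose phi (m : 'I_M) : 'I_C * J := enum_val (widen_ord M_le' m).
have phiE (m : 'I_M) x : (enum_rank x == m :> nat) = (phi m == x).
  apply/eqP/eqP => [xm | <-]; last by rewrite enum_valK.
  by rewrite -[RHS]enum_rankK; congr enum_val; apply: val_inj; rewrite /= xm.
have phi_inj : injective phi.
  by move=> m m' /enum_val_inj /(congr1 val) /= /val_inj.
apply: (@row_orthonormal_graph _ _ _
  (fun u => ((phi u.1).1, pos (iota (phi u.1).2) u.2))).
  move=> [m o] [m' o'] /= [phi1 pos_eq].
  have [phi2 ->] := @pos_inj ((phi m).2, o) ((phi m').2, o') pos_eq.
  congr pair; apply: phi_inj.
  by rewrite [phi m]surjective_pairing phi1 phi2 -surjective_pairing.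
move=> [m o] [c p] /=; rewrite layer_entry_matching /= xpair_eqE.
under eq_bigr do
  rewrite phiE [phi m]surjective_pairing xpair_eqE -mulnb natrM mulrAC mulrC.
by rewrite sum_pred1_mul -natrM mulnb.
Qed.

(** The cardinality equation upgrades [pos_inj] to a bijection: each [p] is read from a unique
    output position by a unique tap of [J]. The single 1 in the column of [(c, p)] lies at that
    position, in the output channel matched with [c] and that tap. *)
Lemma matching_col_orthonormal : (C * #|J| <= M)%N -> #|P| = (#|J| * #|O|)%N ->
  row_orthonormal (fun v u => layer_entry matching_kernel u v).
Proof.
move=> le_M card_P.
have le_M' : (#|{: 'I_C * J}| <= M)%N by rewrite card_prod card_ord.
pose chi x : 'I_M := widen_ord le_M' (enum_rank x).
have chi_inj : injective chi.
  by move=> x y /(congr1 val) /= /val_inj /enum_rank_inj.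
have [q posK qK] : bijective (fun x : J * O => pos (iota x.1) x.2).
  by apply: inj_card_bij => //; rewrite card_P card_prod.
apply: (@row_orthonormal_graph _ _ _
  (fun v => (chi (v.1, (q v.2).1), (q v.2).2))).
  move=> [c p] [c' p'] /= [/val_inj/enum_rank_inj [-> q1] q2].
  congr pair; apply: (can_inj qK).
  by rewrite [LHS]surjective_pairing q1 q2 -surjective_pairing.
move=> [c p] [m o] /=; rewrite layer_entry_matching /= xpair_eqE.
have posE j : (pos (iota j) o == p) = (((q p).1 == j) && ((q p).2 == o)).
  rewrite -xpair_eqE -surjective_pairing eq_sym -{1}(qK p).
  by rewrite (inj_eq pos_inj (q p) (j, o)).
under eq_bigr do rewrite posE -mulnb natrM mulrCA.
by rewrite sum_pred1_mul -natrM mulnb.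
Qed.

End AbstractConvolution.

(** * The two layer matrices as abstract convolutions *)

Section LayerEntries.
Import GRing.Theory.
Local Open Scope ring_scope.
Variables (R : realType) (M C k S N : nat).
Variables (S_gt0 : (0 < S)%N) (N_gt0 : (0 < N)%N).

Definition mxvec_pair (a b : nat) (x : 'I_a * 'I_b) : 'I_(a * b) :=
  mxvec_index x.1 x.2.

Lemma mxvec_pair_bij (a b : nat) : bijective (@mxvec_pair a b).
Proof.
have [g gK Kg] := curry_mxvec_bij a b.
exists g => [[i j] | x]; first by apply: (gK (i, j)); rewrite inE.
by have := Kg x isT; case: (g x).
Qed.

(** The nesting follows the double vectorization in [conv2]: first the two coordinates of an image,
    then the channel. *)
Definition mxvec_triple (a b c : nat) (x : 'I_a * ('I_b * 'I_c)) :
    'I_(a * (b * c)) :=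
  mxvec_pair (x.1, mxvec_pair x.2).

Lemma mxvec_triple_bij (a b c : nat) : bijective (@mxvec_triple a b c).
Proof.
have [h hK Kh] := mxvec_pair_bij b c.
apply: (bij_comp (mxvec_pair_bij a (b * c))).
exists (fun x => (x.1, h x.2)) => [[x y] | [x y]] /=; first by rewrite hK.
by rewrite Kh.
Qed.

Lemma layer1_mxE (K : kernel1 R M C k) u v :
  layer1_mx S_gt0 N_gt0 K (mxvec_pair u) (mxvec_pair v) =
  layer_entry (input_pos S_gt0 N_gt0) K u v.
Proof.
case: u v => m i [c p].
rewrite /layer1_mx mxE mxE /= vec_mx_delta mxvecE mxE.
(* The entry is the response to a basis input supported on channel [c], so the other channels
   contribute nothing. *)
rewrite (bigD1 c) //= [X in _ + X]big1 ?addr0 => [|c' /negPf c'c].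
  by apply: eq_bigr => t _; rewrite mxE eqxx.
by rewrite big1 // => t _; rewrite mxE c'c mulr0.
Qed.

Definition input_pos2 (t : 'I_k * 'I_k) (o : 'I_N * 'I_N) :
    'I_(S * N) * 'I_(S * N) :=
  (input_pos S_gt0 N_gt0 t.1 o.1, input_pos S_gt0 N_gt0 t.2 o.2).

Lemma layer2_mxE (K : kernel2 R M C k) u v :
  layer2_mx S_gt0 N_gt0 K (mxvec_triple u) (mxvec_triple v) =
  layer_entry input_pos2 (fun m c t => K m c t.1 t.2) u v.
Proof.
case: u v => m [i j] [c [p q]].
rewrite /layer2_mx mxE mxE /= vec_mx_delta mxvecE mxE mxvecE mxE.
have deltaE c' a b : vec_mx (row c' (delta_mx c (mxvec_pair (p, q)))) a b =
    ((c' == c) && ((a, b) == (p, q)))%:R :> R.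
  rewrite !mxE; congr (_ && _)%:R.
  by rewrite -(inj_eq (bij_inj (mxvec_pair_bij _ _))).
rewrite (bigD1 c) //= [X in _ + X]big1 ?addr0 => [|c' /negPf c'c].
  rewrite pair_bigA; apply: eq_bigr => t _.
  by rewrite deltaE eqxx.
rewrite big1 // => t _; rewrite big1 // => t' _.
by rewrite deltaE c'c mulr0.
Qed.

(** The shift by [k./2] cancels modulo [S * N]. As [a < S], the number [a + S * i] is below [S * N],
    so it survives the reduction, and Euclidean division by [S] recovers [i] and [a]. *)
Lemma input_pos_inj : injective (fun x : 'I_(minn S k) * 'I_N =>
  input_pos S_gt0 N_gt0 (widen_ord (geq_minr S k) x.1) x.2).
Proof.
move=> [a i] [b j] /= /(congr1 val) /= pos_eq.
have aS := leq_trans (ltn_ord a) (geq_minl S k).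
have bS := leq_trans (ltn_ord b) (geq_minl S k).
have SN_neq0 : (S * N)%:Z != 0 by rewrite eqz_nat -lt0n SN_gt0.
have lt_SN (x : nat) (y : 'I_N) : (x < S)%N -> (x + S * y < S * N)%N.
  move=> xS; apply: leq_trans (_ : S * y.+1 <= _)%N.
    by rewrite mulnS ltn_add2r.
  by rewrite leq_mul2l ltn_ord orbT.
have /eqP : ((a%:Z + S%:Z * i%:Z - (k./2)%:Z) %% (S * N)%:Z)%Z =
    ((b%:Z + S%:Z * j%:Z - (k./2)%:Z) %% (S * N)%:Z)%Z.
  by rewrite -[LHS]gez0_abs ?modz_ge0 // pos_eq gez0_abs ?modz_ge0.
rewrite eqz_modDr -!PoszM -!PoszD !modz_nat eqz_nat !modn_small ?lt_SN //.
move=> /eqP ab_eq.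
have ij : i = j.
  apply: val_inj; have := congr1 (divn^~ S) ab_eq.
  rewrite /= ![(_ + S * _)%N]addnC ![(S * _)%N]mulnC.
  by rewrite !divnMDl // !divn_small // !addn0.
congr pair => //; apply: val_inj.
by move: ab_eq; rewrite ij => /addIn.
Qed.

Definition corner_tap (j : 'I_(minn S k) * 'I_(minn S k)) : 'I_k * 'I_k :=
  (widen_ord (geq_minr S k) j.1, widen_ord (geq_minr S k) j.2).

Lemma input_pos2_inj :
  injective (fun x : ('I_(minn S k) * 'I_(minn S k)) * ('I_N * 'I_N) =>
    input_pos2 (corner_tap x.1) x.2).
Proof.
move=> [[a a'] [i i']] [[b b'] [j j']] /pair_equal_spec [/= eq1 eq2].
have [-> ->] := @input_pos_inj (a, i) (b, j) eq1.
by have [-> ->] := @input_pos_inj (a', i') (b', j') eq2.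
Qed.

Lemma layer1_row_orthonormal (K : kernel1 R M C k) :
  let A := layer1_mx S_gt0 N_gt0 K in
  A *m A^T = 1%:M <-> row_orthonormal (layer_entry (input_pos S_gt0 N_gt0) K).
Proof.
rewrite /= (row_orthonormal_mx _ (mxvec_pair_bij _ _) (mxvec_pair_bij _ _)).
by split=> orth u u'; rewrite -orth; apply: eq_bigr => v _; rewrite !layer1_mxE.
Qed.

Lemma layer1_col_orthonormal (K : kernel1 R M C k) :
  let A := layer1_mx S_gt0 N_gt0 K in
  A^T *m A = 1%:M <->
  row_orthonormal (fun v u => layer_entry (input_pos S_gt0 N_gt0) K u v).
Proof.
rewrite /= (col_orthonormal_mx _ (mxvec_pair_bij _ _) (mxvec_pair_bij _ _)).
by split=> orth v v'; rewrite -orth; apply: eq_bigr => u _; rewrite !layer1_mxE.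
Qed.

Lemma layer2_row_orthonormal (K : kernel2 R M C k) :
  let A := layer2_mx S_gt0 N_gt0 K in
  A *m A^T = 1%:M <->
  row_orthonormal (layer_entry input_pos2 (fun m c t => K m c t.1 t.2)).
Proof.
have triple_bij := mxvec_triple_bij.
rewrite /= (row_orthonormal_mx _ (triple_bij _ _ _) (triple_bij _ _ _)).
by split=> orth u u'; rewrite -orth; apply: eq_bigr => v _; rewrite !layer2_mxE.
Qed.

Lemma layer2_col_orthonormal (K : kernel2 R M C k) :
  let A := layer2_mx S_gt0 N_gt0 K in
  A^T *m A = 1%:M <->
  row_orthonormal
    (fun v u => layer_entry input_pos2 (fun m c t => K m c t.1 t.2) u v).
Proof.
have triple_bij := mxvec_triple_bij.
rewrite /= (col_orthonormal_mx _ (triple_bij _ _ _) (triple_bij _ _ _)).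
by split=> orth v v'; rewrite -orth; apply: eq_bigr => u _; rewrite !layer2_mxE.
Qed.

End LayerEntries.

(** * Existence of orthogonal kernels and the equivalences *)

Lemma orthogonal_kernels1_neq0 (R : realType) (M C k S N : nat)
    (S_gt0 : 0 < S) (N_gt0 : 0 < N) :
  (M <= C * S -> M <= C * minn S k) -> (C * S <= M -> S <= k) ->
  orthogonal_kernels1 R M C k S_gt0 N_gt0 !=set0.
Proof.
move=> rows cols.
(* One kernel must serve both clauses, since both apply when [M = C * S]; hence the two conditional
   hypotheses. *)
exists (matching_kernel R (widen_ord (geq_minr S k))); split=> [/rows | CS_le].
  move=> M_le; apply/layer1_row_orthonormal/matching_row_orthonormal.
    exact: input_pos_inj.
  by rewrite card_ord.
(* Once [S <= k], there are [S] selected taps, and [S * N] is exactly the number of input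
   positions. *)
have /minn_idPl minE := cols CS_le.
apply/layer1_col_orthonormal/matching_col_orthonormal.
- exact: input_pos_inj.
- by rewrite card_ord minE.
- by rewrite !card_ord minE.
Qed.

Lemma orthogonal_kernels2_neq0 (R : realType) (M C k S N : nat)
    (S_gt0 : 0 < S) (N_gt0 : 0 < N) :
  (M <= C * S ^ 2 -> M <= C * minn S k ^ 2) -> (C * S ^ 2 <= M -> S <= k) ->
  orthogonal_kernels2 R M C k S_gt0 N_gt0 !=set0.
Proof.
move=> rows cols; pose K := @matching_kernel R M C _ _ (@corner_tap k S).
(* [==] on pairs compares projections, so [K m c (t.1, t.2)] is convertible to
   [K m c t]. *)
exists (fun m c t t' => K m c (t, t')); split=> [/rows M_le | CS_le].
  apply/layer2_row_orthonormal.
  apply: (@matching_row_orthonormal R M C _ _ _ _ _ (@corner_tap k S)).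
    exact: input_pos2_inj.
  by rewrite card_prod card_ord.
have /minn_idPl minE := cols CS_le.
apply/layer2_col_orthonormal.
apply: (@matching_col_orthonormal R M C _ _ _ _ _ (@corner_tap k S)).
- exact: input_pos2_inj.
- by rewrite card_prod card_ord minE.
- by rewrite !card_prod !card_ord minE mulnACA.
Qed.

Theorem theorem4 (R : realType) (M C k S N : nat)
    (M_gt0 : 0 < M) (C_gt0 : 0 < C) (k_gt0 : 0 < k) (S_gt0 : 0 < S)
    (k_odd : odd k) (N_gt0 : 0 < N) (k_le_SN : k <= S * N) :
  ((M <= C * S ->
      (orthogonal_kernels1 R M C k S_gt0 N_gt0 !=set0 <-> M <= C * k)) /\
   (C * S <= M ->
      (orthogonal_kernels1 R M C k S_gt0 N_gt0 !=set0 <-> S <= k))) /\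
  ((M <= C * S ^ 2 ->
      (orthogonal_kernels2 R M C k S_gt0 N_gt0 !=set0 <-> M <= C * k ^ 2)) /\
   (C * S ^ 2 <= M ->
      (orthogonal_kernels2 R M C k S_gt0 N_gt0 !=set0 <-> S <= k))).
Proof.
have o := Ordinal N_gt0; have c := Ordinal C_gt0.
split; split.
- move=> M_le; split=> [[K [/(_ M_le)/layer1_row_orthonormal orth _]] | M_le'].
    by have := channels_le_of_row_orthonormal o orth; rewrite card_ord.
  apply: orthogonal_kernels1_neq0 => [_ | CS_le].
    by rewrite /minn; case: ifP.
  (* In the square case, [C * S <= M <= C * k] yields the column condition [S <= k]. *)
  by have := leq_trans CS_le M_le'; rewrite leq_pmul2l.
- move=> CS_le; split=> [[K [_ /(_ CS_le)/layer1_col_orthonormal orth]] | S_le].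
    have := positions_le_of_col_orthonormal c orth.
    by rewrite !card_ord leq_pmul2r.
  by apply: orthogonal_kernels1_neq0 => // M_le; rewrite (minn_idPl S_le).
- move=> M_le; split=> [[K [/(_ M_le)/layer2_row_orthonormal orth _]] | M_le'].
    have := channels_le_of_row_orthonormal (o, o) orth.
    by rewrite card_prod card_ord.
  apply: orthogonal_kernels2_neq0 => [_ | CS_le].
    by rewrite /minn; case: ifP.
  by have := leq_trans CS_le M_le'; rewrite leq_pmul2l // leq_exp2r.
- move=> CS_le; split=> [[K [_ /(_ CS_le)/layer2_col_orthonormal orth]] | S_le].
    have := positions_le_of_col_orthonormal c orth.
    (* The count bounds the square of [S * N] by that of [k * N]; square roots and division by [N]
       give [S <= k]. *)
    by rewrite !card_prod !card_ord !mulnn -expnMn leq_exp2r // leq_pmul2r.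
  by apply: orthogonal_kernels2_neq0 => // M_le; rewrite (minn_idPl S_le).
Qed.
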